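(* Every Lindelöf Čech-complete scattered Tychonoff space is $\sigma$-compact.
   Context: A space is scattered if every nonempty subspace of it has an isolated point. A Tychonoff space is Čech-complete if it is a $G_\delta$ subset of its Stone-Čech compactification. A space is $\sigma$-compact if it is a countable union of compact subspaces. *)

(* Defs.v *)
From mathcomp Require Import all_boot all_order all_algebra.
From mathcomp Require Import all_classical all_reals all_analysis.
From mathcomp Require Import borel_hierarchy.

Set Implicit Arguments.
Unset Strict Implicit.
Unset Printing Implicit Defensive.

Import Order.TTheory GRing.Theory Num.Theory.
Import numFieldNormedType.Exports.

Local Open Scope classical_set_scope.
Local Open Scope ring_scope.

(* [completely_regular_space] separates points from closed sets by a
   [uniform_separator]; [uniform_separatorP] is the equivalence with separation
   by a continuous function into the unit interval. *)
Definition tychonoff_space (T : topologicalType) : Prop :=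
  hausdorff_space T /\ completely_regular_space T.

Definition lindelof_space (T : topologicalType) : Prop :=
  forall U : set (set T),
    (forall A, U A -> open A) -> \bigcup_(A in U) A = [set: T] ->
    exists V : set (set T),
      [/\ countable V, V `<=` U & \bigcup_(A in V) A = [set: T]].

Definition scattered_space (T : topologicalType) : Prop :=
  forall A : set T, A !=set0 -> isolated A !=set0.

Definition sigma_compact_space (T : topologicalType) : Prop :=
  exists2 K : (set T)^nat,
    (forall n, compact (K n)) & \bigcup_n K n = [set: T].

Section stone_cech.
Variables (R : realType) (T : topologicalType).

Definition unit_interval : topologicalType := set_type `[0 : R, 1]%classic.

Definition stone_cech_cube : topologicalType :=
  prod_topology (fun _ : continuousType T unit_interval => unit_interval).

Definition stone_cech_eval (x : T) : stone_cech_cube := fun f => f x.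

(* The closure, in the cube indexed by all continuous maps from T to [0, 1], of
   the image of T under evaluation, with the subspace topology. *)
Definition stone_cech : topologicalType :=
  set_type (closure (range stone_cech_eval)).

Lemma stone_cech_eval_closure (x : T) :
  stone_cech_eval x \in closure (range stone_cech_eval).
Proof. by rewrite inE; apply: subset_closure; exists x. Qed.

Definition stone_cech_unit (x : T) : stone_cech :=
  exist _ (stone_cech_eval x) (stone_cech_eval_closure x).

End stone_cech.

(* A Tychonoff space T is identified with its image in the Stone-Cech
   compactification; the choice of the real numbers R is immaterial. *)
Definition cech_complete (R : realType) (T : topologicalType) : Prop :=
  Gdelta (range (@stone_cech_unit R T)).

(* Main.v *)
From HB Require Import structures.
Require Import Defs.
From mathcomp Require Import all_boot all_order all_algebra.
From mathcomp Require Import all_classical all_reals all_analysis.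
From mathcomp Require Import borel_hierarchy.

(** Let F be the closed set of points with no open neighbourhood covered by
    countably many compact sets.  If F is nonempty, scatteredness gives an
    isolated point p of F, say V `&` F = [set p] with V open.
    As T is a G-delta in its Stone-Cech compactification, which is regular,
    there are open sets O_n containing p with closure O_0 `<=` V and
    K = \bigcap_n O_n compact.  Each closure O_0 `\` O_n is closed, hence
    Lindelöf, and misses F, so it is covered by countably many compact sets;
    together with K they cover O_0, contradicting p \in F.  So F is empty, and
    the Lindelöf property concludes. *)

Set Implicit Arguments.
Unset Strict Implicit.
Unset Printing Implicit Defensive.

Import Order.TTheory Num.Theory.
Import numFieldNormedType.Exports.

Local Open Scope classical_set_scope.
Local Open Scope ring_scope.

(** * Maps that induce the topology of their source *)

Section inducing.
Variables (S T : topologicalType) (e : S -> T).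

(** This is one half of [S] carrying the initial topology of [e]; the other half, continuity of [e],
    is assumed separately. *)
Definition inducing := forall U : set S, open U ->
  exists2 V : set T, open V & U = e @^-1` V.

Hypothesis e_inducing : inducing.

(** A proper filter on the preimage pushes forward to one on [K], which clusters at some point of
    [K]. That point is some [e x] because [K] lies in the range, and clustering returns to [x] since
    the open sets around [x] are preimages. *)
Lemma inducing_compact (K : set T) :
  compact K -> K `<=` range e -> compact (e @^-1` K).
Proof.
move=> cK Ke F PF FK.
have [z [Kz]] := cK (e @ F) _ FK.
have [x _ exz] := Ke _ Kz; rewrite -{}exz in Kz * => clx.
exists x; split => // A B FA; rewrite nbhsE => -[U [oU Ux] UB].
have [V oV UV] := e_inducing oU; move: Ux; rewrite UV => Vex.
have [|y [Ay Vy]] := clx (e @` A) V _ (open_nbhs_nbhs (conj oV Vex)).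
  exact: filterS (@preimage_image _ _ e A) FA.
by case: Ay Vy => t At <- Vet; exists t; split => //; apply: UB; rewrite UV.
Qed.

Lemma inducing_hausdorff :
  injective e -> continuous e -> hausdorff_space T -> hausdorff_space S.
Proof.
move=> inj_e cont_e hT x y clxy; apply/inj_e/hT => A B Aex Bey.
by have [z [Az Bz]] := clxy _ _ (cont_e _ _ Aex) (cont_e _ _ Bey); exists (e z).
Qed.

End inducing.

Lemma set_val_inducing (T : topologicalType) (A : set T) :
  inducing (@set_val T A).
Proof. by move=> U [V oV <-]; exists V. Qed.

Lemma set_val_continuous (T : topologicalType) (A : set T) :
  continuous (@set_val T A).
Proof. exact: initial_continuous. Qed.

Lemma set_val_inj (T : Type) (A : set T) : injective (@set_val T A).
Proof. exact: val_inj. Qed.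

Lemma set_type_compact (T : topologicalType) (A : set T) :
  compact A -> compact [set: set_type A].
Proof.
move=> cA; rewrite (_ : setT = set_val @^-1` A).
  apply: (inducing_compact (@set_val_inducing _ A)) => // x Ax.
  by exists (SigSub (mem_set Ax)).
by apply/seteqP; split => // x _; exact: set_valP.
Qed.

Lemma set_type_hausdorff (T : topologicalType) (A : set T) :
  hausdorff_space T -> hausdorff_space (set_type A).
Proof.
exact: inducing_hausdorff (@set_val_inj _ A) (@set_val_continuous _ A).
Qed.

(** * The Stone-Čech compactification is compact Hausdorff and induces the topology of [T] *)

Section stone_cech_theory.
Variables (R : realType) (T : topologicalType).

Lemma unit_interval_compact : compact [set: unit_interval R].
Proof. exact: set_type_compact (@segment_compact R 0 1). Qed.

Lemma unit_interval_hausdorff : hausdorff_space (unit_interval R).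
Proof. exact: set_type_hausdorff (@Rhausdorff R). Qed.

Lemma stone_cech_cube_compact : compact [set: stone_cech_cube R T].
Proof.
have := @tychonoff {classic continuousType T (unit_interval R)} _ _
  (fun=> unit_interval_compact).
by rewrite (_ : [set f | _] = setT)//; apply/seteqP.
Qed.

Lemma stone_cech_cube_hausdorff : hausdorff_space (stone_cech_cube R T).
Proof. apply: hausdorff_product => ?; exact: unit_interval_hausdorff. Qed.

Lemma stone_cech_compact : compact [set: stone_cech R T].
Proof.
apply: set_type_compact.
exact: (subclosed_compact (@closed_closure _ _) stone_cech_cube_compact).
Qed.

Lemma stone_cech_hausdorff : hausdorff_space (stone_cech R T).
Proof. exact: set_type_hausdorff stone_cech_cube_hausdorff. Qed.

Lemma stone_cech_eval_continuous : continuous (@stone_cech_eval R T).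
Proof.
(* The product topology is a supremum over the coordinates, and the coordinate [f] of the evaluation
   map is [f] itself. *)
move=> x; apply/cvg_sup => f U /= [_ [[V oV <-] Vfx] VU].
apply: (filterS VU); apply: (@cts_fun _ _ f x V).
by apply: open_nbhs_nbhs; split.
Qed.

Lemma stone_cech_unit_continuous : continuous (@stone_cech_unit R T).
Proof.
apply/continuousP => _ [V oV <-].
apply: (@open_comp _ _ (@stone_cech_eval R T)) oV => x _.
exact: stone_cech_eval_continuous.
Qed.

(** A function into the unit interval that is 0 at [x] and 1 off [U] is itself a coordinate of the
    cube; [V] is the locus where this coordinate is less than 1. *)
Lemma stone_cech_separation (x : T) (U : set T) :
  completely_regular_space T -> open U -> U x ->
  exists2 V : set (stone_cech R T), open V /\ V (stone_cech_unit R x) &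
    @stone_cech_unit R T @^-1` V `<=` U.
Proof.
move=> crT oU Ux.
have /(@uniform_separatorP _ R)[f [cf f01 fx0 fU1]] :=
  crT x (~` U) (open_closedC oU) (fun nUx => nUx Ux).
have f01_mem t : f t \in `[0, 1]%classic by rewrite inE; apply: f01; exists t.
pose g t : unit_interval R := SigSub (f01_mem t).
have cg : continuous g.
  apply/continuousP => _ [W oW <-].
  by apply: (@open_comp _ _ f) oW => ? _; exact: cf.
pose gc : continuousType T (unit_interval R) :=
  HB.pack_for (continuousType T (unit_interval R)) g
    (isContinuous.Build _ _ g cg).
pose pr (s : stone_cech R T) : R := set_val (proj gc (set_val s)).
exists (pr @^-1` [set r | r < 1]); first split.
- exists (proj gc @^-1` (set_val @^-1` [set r : R | r < 1])) => //.
  apply: open_comp => [? _|]; first exact: proj_continuous.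
  by exists [set r : R | r < 1] => //; exact: open_lt.
- by rewrite /= (_ : pr _ = 0) ?ltr01//; apply: fx0; exists x.
- move=> t /= ft1; apply: contrapT => nUt; move: ft1.
  by rewrite (_ : pr _ = 1) ?ltxx//; apply: fU1; exists t.
Qed.

Lemma stone_cech_unit_inducing :
  completely_regular_space T -> inducing (@stone_cech_unit R T).
Proof.
move=> crT U oU.
(* Taking all admissible [V] at once avoids choosing one for each point of [U]. *)
pose Vs := [set V | open V /\ @stone_cech_unit R T @^-1` V `<=` U].
exists (\bigcup_(V in Vs) V).
  by apply: bigcup_open => V [].
apply/seteqP; split => [x Ux|x [V [_ VU]]]; last exact: VU.
by have [V [oV Vx] VU] := stone_cech_separation crT oU Ux; exists V.
Qed.

End stone_cech_theory.

(** * Sets covered by countably many compact sets *)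

Section sigma_compact_cover.
Variable T : topologicalType.
Implicit Types A B F : set T.

(** Inclusion instead of equality makes the notion hereditary, so arbitrary subsets can be
    handled. *)
Definition sigma_compact_covered A := exists2 K : (set T)^nat,
  forall n, compact (K n) & A `<=` \bigcup_n K n.

Lemma sub_sigma_compact_covered A B :
  A `<=` B -> sigma_compact_covered B -> sigma_compact_covered A.
Proof. by move=> AB [K cK /(subset_trans AB)]; exists K. Qed.

Lemma compact_sigma_compact_covered A : compact A -> sigma_compact_covered A.
Proof. by exists (fun=> A) => // x Ax; exists 0%N. Qed.

Lemma bigcup_sigma_compact_covered (A : (set T)^nat) :
  (forall n, sigma_compact_covered (A n)) ->
  sigma_compact_covered (\bigcup_n A n).
Proof.
move=> /(_ _)/cid2-/all_sig2[K cK AK].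
(* The double sequence is indexed by codes of pairs; numbers coding no pair get the empty set, which
   is compact. *)
exists (fun m => if unpickle m is Some (n, k) then K n k else set0).
  by move=> m; case: unpickle => [[n k]|]; [exact: cK|exact: compact0].
move=> x [n _ /AK[k _ Kx]]; exists (pickle (n, k)) => //.
by rewrite pickleK.
Qed.

Lemma setU_sigma_compact_covered A B :
  sigma_compact_covered A -> sigma_compact_covered B ->
  sigma_compact_covered (A `|` B).
Proof.
move=> cA cB; rewrite -bigcup2E; apply: bigcup_sigma_compact_covered.
by case=> [|[|n]] //=; apply/compact_sigma_compact_covered/compact0.
Qed.

(** Adding the complement of [F] to the covered open sets gives an open cover of the whole space, to
    which the Lindelöf property applies; the complement contributes nothing to [F]. *)
Lemma closed_sigma_compact_covered F : lindelof_space T -> closed F ->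
  (forall x, F x -> exists2 O, open O /\ O x & sigma_compact_covered O) ->
  sigma_compact_covered F.
Proof.
move=> lT clF locF.
pose U := [set O | open O /\ (sigma_compact_covered O \/ O = ~` F)].
have [A []//| |V [cV VU VT]] := lT U.
  apply/seteqP; split => // x _.
  have [/locF[ O [oO Ox] cO]|nFx] := pselect (F x).
    by exists O => //; split => //; left.
  by exists (~` F) => //; split; [rewrite openC|right].
have FV : F `<=` \bigcup_(O in V) (O `&` F).
  move=> x Fx; have : [set: T] x by [].
  by rewrite -VT => -[ O VO Ox]; exists O.
apply: (sub_sigma_compact_covered FV).
have covO O : V O -> sigma_compact_covered (O `&` F).
  move=> /VU[_ [cO|->]].
    by apply: sub_sigma_compact_covered cO; exact: subIsetl.
  by rewrite setICl; apply/compact_sigma_compact_covered/compact0.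
(* A countable family is either empty or the image of a surjection from the naturals. *)
move/pfcard_geP : cV => [->|[f]].
  by rewrite bigcup_set0; apply/compact_sigma_compact_covered/compact0.
rewrite (_ : \bigcup_(O in V) _ = \bigcup_n (f n `&` F)).
  by apply: bigcup_sigma_compact_covered => n; apply: covO; exact: funS.
apply/seteqP; split => x [].
  by move=> O /(@surj _ _ _ _ f)[n _ <-] ?; exists n.
by move=> n _ ?; exists (f n) => //; exact: funS.
Qed.

End sigma_compact_cover.

(** Regularity of [C] yields open neighbourhoods of [e p], the closure of each lying in the
    preceding one and in [G n]. Their intersection equals that of their closures, hence is compact
    and inside the range of [e], so its preimage is compact. *)
Lemma compact_Gdelta_refinement (S C : topologicalType) (e : S -> C) (p : S)
    (V : set S) :
  inducing e -> continuous e -> hausdorff_space C -> compact [set: C] ->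
  Gdelta (range e) -> open V -> V p ->
  exists O : (set S)^nat, [/\ forall n, open (O n) /\ O n p,
    compact (\bigcap_n O n) & closure (O 0%N) `<=` V].
Proof.
move=> ind_e cont_e hC cC [G oG Ge] oV Vp.
have [V' oV' VV'] := ind_e _ oV; rewrite {}VV' in Vp *.
pose nb := {A : set C | open A /\ A (e p)}.
have step (n : nat) (A : nb) :
    exists B : nb, closure (sval B) `<=` sval A `&` G n.
  case: A => A [oA Aep] /=.
  have nbAG : nbhs (e p) (A `&` G n).
    apply: open_nbhs_nbhs; split; first exact: openI.
    split=> //; have : range e (e p) by exists p.
    by rewrite Ge; apply.
  have [B] := compact_regular hC cC filterT nbAG.
  rewrite nbhsE => -[B' [oB' B'p] B'B] clB.
  exists (exist _ B' (conj oB' B'p)) => /=.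
  exact: subset_trans (closureS B'B) clB.
pose next n A := sval (cid (step n A)).
(* [V'] only seeds the recursion: already the closure of [O 0] lies in both [V'] and [G 0], so no
   [G n] is skipped. *)
pose fix O (n : nat) : nb :=
  if n is m.+1 then next m.+1 (O m) else next 0%N (exist _ V' (conj oV' Vp)).
have clO0 : closure (sval (O 0%N)) `<=` V' `&` G 0%N.
  exact: (svalP (cid (step _ _))).
have clOS n : closure (sval (O n.+1)) `<=` sval (O n) `&` G n.+1.
  exact: (svalP (cid (step _ _))).
exists (fun n => e @^-1` sval (O n)); split.
- move=> n; have [oO Op] := svalP (O n); split => //.
  by apply: open_comp => // ? _; exact: cont_e.
- rewrite (_ : \bigcap_n _ = e @^-1` \bigcap_n closure (sval (O n))).
    apply: inducing_compact => //.
      apply: subclosed_compact cC _ => //.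
      by apply: closed_bigI => n _; exact: closed_closure.
    rewrite Ge => x Ox [|n] _.
      by have [] := clO0 _ (Ox 0%N I).
    by have [] := clOS _ _ (Ox n.+1 I).
  (* A point of every closure is in [O n] because the closure of [O n.+1] is contained in [O n]. *)
  apply/seteqP; split => x Ox n _; first exact/subset_closure/Ox.
  by have [] := clOS _ _ (Ox n.+1 I).
- apply: (@subset_trans _ (e @^-1` closure (sval (O 0%N)))).
    rewrite closureE; apply: smallest_sub.
      apply: closed_comp; last exact: closed_closure.
      by move=> ? _; exact: cont_e.
    by move=> x Ox; exact: subset_closure.
  by move=> x /clO0[].
Qed.

Theorem theorem4p5 (R : realType) (T : topologicalType)
    (T_tychonoff : tychonoff_space T) (T_lindelof : lindelof_space T)
    (T_cech_complete : cech_complete R T) (T_scattered : scattered_space T) :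
  sigma_compact_space T.
Proof.
have [_ crT] := T_tychonoff.
pose good x := exists2 O : set T, open O /\ O x & sigma_compact_covered O.
suff all_good x : good x.
  have [K cK TK] := closed_sigma_compact_covered T_lindelof closedT
    (fun x _ => all_good x).
  by exists K => //; apply/seteqP; split.
apply: contrapT => nx.
have [p [/set_mem np [V nbV Vp]]] := T_scattered (~` good) (ex_intro _ x nx).
(* Isolation only provides a neighbourhood [V] of [p], so the refinement is taken inside its
   interior. *)
have [| O [Op cK clO]] := compact_Gdelta_refinement
  (stone_cech_unit_inducing R crT) (@stone_cech_unit_continuous R T)
  (@stone_cech_hausdorff R T) (@stone_cech_compact R T) T_cech_complete
  (@open_interior _ V) _ (p := p); first exact: nbV.
have [oO0 O0p] := Op 0%N; apply: np; exists (O 0%N) => //.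
pose D n := closure (O 0%N) `\` O n.
apply: (@sub_sigma_compact_covered _ _ (\bigcap_n O n `|` \bigcup_n D n)).
  move=> y O0y; have [?|] := pselect ((\bigcap_n O n) y); first by left.
  move=> /existsNP[n /not_implyP[_ nOy]]; right; exists n => //.
  by split => //; exact: subset_closure.
apply: setU_sigma_compact_covered; first exact: compact_sigma_compact_covered.
apply: bigcup_sigma_compact_covered => n.
apply: closed_sigma_compact_covered => //.
  by apply: closedI; [exact: closed_closure|exact/open_closedC/(Op n).1].
(* The only point of [V] that is not good is [p], and [p] belongs to [O n], so every point of [D n]
   is good. *)
move=> y [/clO/interior_subset Vy nOy]; apply: contrapT => ny.
have : [set p] y by rewrite -Vp.
by move=> yp; apply: nOy; rewrite yp; exact: (Op n).2.
Qed.
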